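(* Let $(X,\triangleright)$ be a rack whose group of inner automorphisms is bounded and amenable. Then for every $k$ there is an isomorphism $$\operatorname{Fun}_b(\pi_0(X,\triangleright)^k,\mathbb R)\cong H^k_b(X;\mathbb R),$$ where $\operatorname{Fun}_b(\pi_0(X,\triangleright)^k,\mathbb R)$ denotes the space of bounded real functions on the $k$-fold product of the set $\pi_0(X,\triangleright)$ of connected components of the rack.
   Context: A rack is a non-empty set $X$ with a binary operation $\triangleright$ such that for every $x\in X$ the map $\psi_x(y)=x\triangleright y$ is a bijection of $X$, and $x\triangleright(y\triangleright z)=(x\triangleright y)\triangleright(x\triangleright z)$ for all $x,y,z$. The group of inner automorphisms $G_\psi$ is the group of bijections of $X$ generated by all $\psi_x$, $x\in X$; the connected components of $X$ are its orbits, and $\pi_0(X,\triangleright)$ is the set of connected components. A group $G$ is bounded if every bi-invariant metric on $G$ has finite diameter. A (discrete) group $G$ is amenable if there is a linear functional $\mathbf m\colon\ell^\infty(G)\to\mathbb R$ with $\mathbf m(1)=1$, $\mathbf m(\varphi)\ge0$ whenever $\varphi\ge0$, and $\mathbf m(\varphi\circ R_h)=\mathbf m(\varphi)$ for all $h\in G$, where $R_h(g)=gh$. The rack bounded cohomology $H^*_b(X;\mathbb R)$ is the cohomology of the complex $C^*_b(X;\mathbb R)$ in which $C^k_b(X;\mathbb R)$ is the space of bounded functions $f\colon X^k\to\mathbb R$, with differential $$\delta f(x_1,\dots,x_{k+1})=\sum_{i=1}^k(-1)^{i-1}f(x_1,\dots,x_{i-1},x_{i+1},\dots,x_{k+1})-\sum_{i=1}^k(-1)^{i-1}f(x_1,\dots,x_{i-1},x_i\triangleright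 x_{i+1},\dots,x_i\triangleright x_{k+1}).$$ *)

(* Defs.v *)
From HB Require Import structures.
From mathcomp Require Import all_boot all_order all_algebra.
From mathcomp Require Import generic_quotient ring_quotient.
From mathcomp Require Import boolp classical_sets functions reals.
From mathcomp Require Import topology normedtype.

Set Implicit Arguments.
Unset Strict Implicit.
Unset Printing Implicit Defensive.

Import Order.TTheory GRing.Theory Num.Theory.
Import numFieldNormedType.Exports.

Local Open Scope classical_set_scope.
Local Open Scope ring_scope.

Section Bijections.
Variable X : choiceType.

Definition bijection := set_type [set f : X -> X | bijective f].

HB.instance Definition _ := SubChoice.on bijection.

Definition Bijection (f : X -> X) (bij_f : bijective f) : bijection :=
  SigSub (mem_set bij_f : f \in [set g : X -> X | bijective g]).

Definition bijection_fun (f : bijection) : X -> X := val f.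

Lemma bijectionP (f : bijection) : bijective (bijection_fun f).
Proof. exact: set_valP. Qed.

Lemma bijection_invP (f : bijection) :
  exists g : bijection, cancel (bijection_fun f) (bijection_fun g) /\
                        cancel (bijection_fun g) (bijection_fun f).
Proof.
have [g fK gK] := bijectionP f.
by exists (Bijection (Bijective gK fK)).
Qed.

Fact id_bij : bijective (@id X).
Proof. by exists id. Qed.

Definition bijection_one : bijection := Bijection id_bij.

Definition bijection_mul (f g : bijection) : bijection :=
  Bijection (bij_comp (bijectionP f) (bijectionP g)).

Definition bijection_inv (f : bijection) : bijection :=
  sval (cid (bijection_invP f)).

Fact bijection_mulA : associative bijection_mul.
Proof. by move=> f g h; apply: val_inj. Qed.

Fact bijection_mul1 : left_id bijection_one bijection_mul.
Proof. by move=> f; apply: val_inj. Qed.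

Fact bijection_mulr1 : right_id bijection_one bijection_mul.
Proof. by move=> f; apply: val_inj. Qed.

Fact bijection_mulV : left_inverse bijection_one bijection_inv bijection_mul.
Proof.
move=> f; apply: val_inj; apply: funext => x /=; rewrite /bijection_inv.
by case: cid => g [fK gK] /=; exact: fK.
Qed.

Fact bijection_mulrV : right_inverse bijection_one bijection_inv bijection_mul.
Proof.
move=> f; apply: val_inj; apply: funext => x /=; rewrite /bijection_inv.
by case: cid => g [fK gK] /=; exact: gK.
Qed.

HB.instance Definition _ := isGroup.Build bijection
  bijection_mulA bijection_mul1 bijection_mulr1 bijection_mulV bijection_mulrV.

End Bijections.

Coercion bijection_fun : bijection >-> Funclass.

Section GeneratedSubgroup.
Variables (G : groupType) (S : set G).

Definition generated : set G := smallest (fun H => group_closed [in H]) S.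

Fact generated_group_closed : group_closed [in generated].
Proof.
split; first by apply/mem_set => H [[/set_mem]].
move=> u v /set_mem gu /set_mem gv; apply/mem_set => H SH.
by apply/set_mem/SH.1.2; apply/mem_set; [exact: gu|exact: gv].
Qed.

Definition generated_group := set_type generated.

HB.instance Definition _ := SubChoice.on generated_group.
HB.instance Definition _ :=
  SubChoice_isSubGroup.Build G [in generated] generated_group
    generated_group_closed.

End GeneratedSubgroup.

(* Requiring a [choiceType] carrier loses no generality: [gen_eqMixin] and
   [gen_choiceMixin] equip every type with this structure. *)
HB.mixin Record isRack X of Choice X := {
  rack_inhabited : inhabited X;
  rack_op : X -> X -> X;
  rack_op_bij : forall x, bijective (rack_op x);
  rack_opD : forall x y z,
    rack_op x (rack_op y z) = rack_op (rack_op x y) (rack_op x z)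
}.

#[short(type="rackType")]
HB.structure Definition Rack := {X of isRack X & Choice X}.

Reserved Notation "x ▷ y" (at level 40, left associativity).
Notation "x ▷ y" := (rack_op x y) : ring_scope.

Section RackComponents.
Variable X : rackType.

Definition rack_psi (x : X) : bijection X := Bijection (rack_op_bij x).

Definition inner_group : groupType := generated_group (range rack_psi).

Definition inner_act (g : inner_group) : X -> X := (val g : bijection X).

Definition component (x : X) : set X := range (fun g => inner_act g x).

(* The set of orbits, each orbit being a subset of [X]. *)
Definition pi0 := set_type (range component).

End RackComponents.

Section BoundedFunctions.
Variables (R : realType) (T : Type).

Definition bounded_functions : set (T -> R^o) :=
  [set f | [bounded f x | x in setT]].

Lemma bounded_functionsP (f : T -> R^o) :
  bounded_functions f <-> exists M : R, forall x, `|f x| <= M.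
Proof.
split=> [[M [_ fM]]|[M fM]].
  by exists (M + 1) => x; apply: (fM (M + 1)) => //; rewrite ltrDl.
exists M; split; first exact: num_real.
by move=> N MN x _; exact: le_trans (fM x) (ltW MN).
Qed.

Fact bounded_functions_submod : submod_closed [in bounded_functions].
Proof.
split; first by apply/mem_set/bounded_functionsP; exists 0 => x; rewrite normr0.
move=> a f g /set_mem/bounded_functionsP[M fM] /set_mem/bounded_functionsP[N gN].
apply/mem_set/bounded_functionsP; exists (`|a| * M + N) => x.
by rewrite (le_trans (ler_normD _ _))// lerD// normrM ler_wpM2l.
Qed.

Definition bfun := set_type bounded_functions.

HB.instance Definition _ := SubChoice.on bfun.
HB.instance Definition _ :=
  GRing.SubChoice_isSubLmodule.Build R (T -> R^o) [in bounded_functions] bfun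
    bounded_functions_submod.

Definition bfun_fun (f : bfun) : T -> R := val f.

Lemma bfunP (f : bfun) : exists M : R, forall x, `|bfun_fun f x| <= M.
Proof. exact/bounded_functionsP/set_valP. Qed.

Definition Bfun (f : T -> R) (bf : exists M : R, forall x, `|f x| <= M) : bfun :=
  SigSub (mem_set ((bounded_functionsP f).2 bf) : (f : T -> R^o) \in bounded_functions).

End BoundedFunctions.

Coercion bfun_fun : bfun >-> Funclass.

Section BoundedFunctionConstructions.
Variable R : realType.

Fact bfun_cst_bounded (T : Type) (c : R) : exists M : R, forall x : T, `|c| <= M.
Proof. by exists `|c|. Qed.

Definition bfun_cst T c : bfun R T := Bfun (@bfun_cst_bounded T c).

Fact bfun_comp_bounded (S T : Type) (f : bfun R T) (u : S -> T) :
  exists M : R, forall x, `|f (u x)| <= M.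
Proof. by have [M fM] := bfunP f; exists M. Qed.

Definition bfun_comp S T (f : bfun R T) (u : S -> T) : bfun R S :=
  Bfun (bfun_comp_bounded f u).

End BoundedFunctionConstructions.

Section BoundedAmenable.
Variables (R : realType) (G : groupType).

Definition metric (d : G -> G -> R) : Prop :=
  [/\ forall x y, 0 <= d x y,
      forall x y, d x y = 0 <-> x = y,
      forall x y, d x y = d y x &
      forall x y z, d x z <= d x y + d y z].

Definition biinvariant (d : G -> G -> R) : Prop :=
  forall g x y, d (g * x)%g (g * y)%g = d x y /\ d (x * g)%g (y * g)%g = d x y.

Definition bounded_group : Prop :=
  forall d, metric d -> biinvariant d -> exists D, forall x y, d x y <= D.

Definition amenable : Prop :=
  exists m : {scalar bfun R G},
    [/\ m (bfun_cst G 1) = 1,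
        forall phi : bfun R G, (forall g, 0 <= phi g) -> 0 <= m phi &
        forall (h : G) (phi : bfun R G),
          m (bfun_comp phi (fun g => (g * h)%g)) = m phi].

End BoundedAmenable.

Section LmodQuotient.
Local Open Scope quotient_scope.
Variables (R : pzRingType) (V : lmodType R).
Variables (W : {pred V}) (submodW : submod_closed W).

Definition submod_pred of submod_closed W : {pred V} := W.

HB.instance Definition _ :=
  GRing.isSubmodClosed.Build R V (submod_pred submodW) submodW.

Definition lmod_quot := Quotient.quot (submod_pred submodW).

HB.instance Definition _ := GRing.Zmodule.on lmod_quot.
HB.instance Definition _ := EqQuotient.on lmod_quot.

Definition lmod_quot_scale (a : R) (x : lmod_quot) : lmod_quot :=
  \pi_lmod_quot (a *: repr x).

Lemma lmod_quot_scale_pi a (v : V) :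
  lmod_quot_scale a (\pi_lmod_quot v) = \pi_lmod_quot (a *: v).
Proof.
apply/eqP; rewrite /lmod_quot_scale -Quotient.idealrBE -scalerBr.
by rewrite rpredZ// Quotient.idealrBE reprK.
Qed.

Fact lmod_quot_scaleA a b x :
  lmod_quot_scale a (lmod_quot_scale b x) = lmod_quot_scale (a * b) x.
Proof. by rewrite -[x in LHS]reprK !lmod_quot_scale_pi scalerA reprK. Qed.

Fact lmod_quot_scale1 : left_id 1 lmod_quot_scale.
Proof. by move=> x; rewrite -[x]reprK lmod_quot_scale_pi scale1r. Qed.

Fact lmod_quot_scaleDr : right_distributive lmod_quot_scale +%R.
Proof.
move=> a x y; rewrite -[x]reprK -[y]reprK -raddfD !lmod_quot_scale_pi.
by rewrite scalerDr raddfD.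
Qed.

Fact lmod_quot_scaleDl x : {morph lmod_quot_scale^~ x : a b / a + b}.
Proof.
by move=> a b; rewrite -[x]reprK !lmod_quot_scale_pi scalerDl raddfD.
Qed.

HB.instance Definition _ := GRing.Zmodule_isLmodule.Build R lmod_quot
  lmod_quot_scaleA lmod_quot_scale1 lmod_quot_scaleDr lmod_quot_scaleDl.

End LmodQuotient.

Section RackBoundedCohomology.
Variables (R : realType) (X : rackType).

Local Notation cochain k := (bfun R ('I_k -> X)).

Section Differential.
Variable k : nat.
Implicit Types (i : 'I_k) (x : 'I_k.+1 -> X).

(* With 0-based indices, [i : 'I_k] stands for the index [i + 1] of the usual
   formula, so that its sign is [(-1) ^+ i] and the last entry of [x] is never
   removed. *)
Definition face_index i : 'I_k.+1 := widen_ord (leqnSn k) i.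

Definition face_del i x : 'I_k -> X := fun j => x (lift (face_index i) j).

(* [lift (face_index i) j] is [j] if [j < i] and [j + 1] otherwise. *)
Definition face_act i x : 'I_k -> X := fun j =>
  let y := x (lift (face_index i) j) in
  if (j < i)%N then y else x (face_index i) ▷ y.

Definition delta_fun (f : cochain k) x : R :=
  \sum_(i < k) (-1) ^+ i * f (face_del i x)
  - \sum_(i < k) (-1) ^+ i * f (face_act i x).

Fact delta_bounded f : exists M : R, forall x, `|delta_fun f x| <= M.
Proof.
have [M fM] := bfunP f; exists (\sum_(i < k) M + \sum_(i < k) M) => x.
rewrite (le_trans (ler_normB _ _))// lerD// (le_trans (ler_norm_sum _ _ _))//.
  by apply: ler_sum => i _; rewrite normrM normrX normrN1 expr1n mul1r.
by apply: ler_sum => i _; rewrite normrM normrX normrN1 expr1n mul1r.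
Qed.

Definition delta (f : cochain k) : cochain k.+1 := Bfun (delta_bounded f).

Fact delta_linear : linear delta.
Proof.
move=> a f g; apply: val_inj; apply: funext => x.
have sumE (u : 'I_k -> 'I_k -> X) :
    \sum_(i < k) (-1) ^+ i * bfun_fun (a *: f + g) (u i) =
    a * (\sum_(i < k) (-1) ^+ i * bfun_fun f (u i)) + \sum_(i < k) (-1) ^+ i * bfun_fun g (u i).
  rewrite mulr_sumr -big_split/=; apply: eq_bigr => i _.
  by rewrite [bfun_fun _ _]/(a * bfun_fun f (u i) + bfun_fun g (u i)) mulrDr mulrCA.
rewrite [LHS]/(delta_fun _ _) [RHS]/(a * delta_fun f x + delta_fun g x).
by rewrite /delta_fun !sumE mulrBr opprD addrACA.
Qed.

HB.instance Definition _ :=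
  GRing.isLinear.Build R (cochain k) (cochain k.+1) _ delta delta_linear.

Definition cocycles : set (cochain k) := [set f | delta f = 0].

Fact cocycles_submod : submod_closed [in cocycles].
Proof.
split; first by apply/mem_set; exact: linear0.
move=> a f g /set_mem df /set_mem dg; apply/mem_set.
rewrite /cocycles/= delta_linear.
by rewrite (df : delta f = 0) (dg : delta g = 0) scaler0 addr0.
Qed.

Definition cocycle := set_type cocycles.

HB.instance Definition _ := SubChoice.on cocycle.
HB.instance Definition _ :=
  GRing.SubChoice_isSubLmodule.Build R (cochain k) [in cocycles] cocycle
    cocycles_submod.

End Differential.

(* The complex is extended by zero in degree -1. *)
Definition coboundaries (k : nat) : set (cochain k) :=
  match k with
  | 0 => [set 0]
  | j.+1 => range (@delta j)
  end.

Definition cocycle_coboundaries k : {pred cocycle k} :=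
  [in [set z : cocycle k | coboundaries (val z)]].

Fact cocycle_coboundaries_submod k : submod_closed (@cocycle_coboundaries k).
Proof.
split.
  apply/mem_set; case: k => [|k] //=.
  by exists 0 => //; rewrite linear0.
move=> a u v /set_mem + /set_mem; rewrite /= => bu bv; apply/mem_set => /=.
case: k u v bu bv => [|k] u v /=.
  by move=> -> ->; rewrite scaler0 addr0.
by move=> [f _ <-] [g _ <-]; exists (a *: f + g) => //; rewrite linearP.
Qed.

Definition rack_bounded_cohomology k : lmodType R :=
  lmod_quot (cocycle_coboundaries_submod k).

End RackBoundedCohomology.

(* Main.v *)
(* Pullback along the projection to components sends [Fun_b(pi0^k)] to cocycles.
   Word length in the generators [psi_x^{+-1}] is conjugation invariant, so
   boundedness of the inner group bounds it by some N. Since [f |-> f(x, .)] is a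
   homotopy between the identity and [psi_x], every cocycle f differs from its
   translate by g by the coboundary of a cochain of norm at most N|f|; averaging
   over g with the mean makes f invariant under the diagonal action. For invariant
   f, [(delta f)(x, y) = - delta (f(x, .)) y], so the slices f(x, .) are cocycles of
   lower degree; by induction they are uniformly cohomologous to functions constant
   on components, and averaging the primitives over the diagonal action turns this
   into the same statement for f. The same slicing shows that a coboundary constant
   on components vanishes. *)
Require Import Defs.
From HB Require Import structures.
From mathcomp Require Import all_boot all_order all_algebra.
From mathcomp Require Import generic_quotient ring_quotient.
From mathcomp Require Import boolp classical_sets functions reals.

Set Implicit Arguments.
Unset Strict Implicit.
Unset Printing Implicit Defensive.

Import Order.TTheory GRing.Theory Num.Theory.

Local Open Scope ring_scope.

(** * Word length for a conjugation-invariant generating set *)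

Section BoundedGeneration.
Variables (R : realType) (G : groupType) (S : set G).
Hypothesis SV : forall s, S s -> S (s^-1)%g.
Hypothesis SJ : forall s g, S s -> S (s ^ g)%g.
Hypothesis Sgen :
  forall g, exists2 s : seq G, (forall a, a \in s -> S a) & g = (\prod_(a <- s) a)%g.

Let word n g := exists s : seq G,
  [/\ size s = n, (forall a, a \in s -> S a) & g = (\prod_(a <- s) a)%g].

Let word_ex g : exists n, `[< word n g >].
Proof. by have [s Ss gE] := Sgen g; exists (size s); apply/asboolP; exists s. Qed.

Let len g := ex_minn (word_ex g).

Let len_word g : word (len g) g.
Proof. by rewrite /len; case: ex_minnP => n /asboolP. Qed.

Let len_le n g : word n g -> (len g <= n)%N.
Proof. by move=> w; rewrite /len; case: ex_minnP => m _; apply; exact/asboolP. Qed.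

Let len1 : len 1%g = 0.
Proof.
by apply/eqP; rewrite -leqn0; apply: len_le; exists [::]; split=> //; rewrite big_nil.
Qed.

Let len0 g : len g = 0 -> g = 1%g.
Proof.
by have [s [<- _ ->]] := len_word g => /size0nil->; rewrite big_nil.
Qed.

Let lenM g h : (len (g * h)%g <= len g + len h)%N.
Proof.
have [s [sn Ss gE]] := len_word g; have [t [tn St hE]] := len_word h.
apply: len_le; exists (s ++ t); split; first by rewrite size_cat sn tn.
  by move=> a; rewrite mem_cat => /orP[/Ss|/St].
by rewrite big_cat -gE -hE.
Qed.

Let lenV_le g : (len (g^-1)%g <= len g)%N.
Proof.
have [s [sn Ss gE]] := len_word g.
apply: len_le; exists [seq (a^-1)%g | a <- rev s]; split.
- by rewrite size_map size_rev sn.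
- by move=> _ /mapP[a + ->]; rewrite mem_rev => /Ss/SV.
- by rewrite big_map prodgV revK -gE.
Qed.

Let lenV g : len (g^-1)%g = len g.
Proof. by apply/eqP; rewrite eqn_leq lenV_le /= -{1}(invgK g) lenV_le. Qed.

Let lenJ_le g h : (len (g ^ h)%g <= len g)%N.
Proof.
have [s [sn Ss gE]] := len_word g.
apply: len_le; exists [seq (a ^ h)%g | a <- s]; split.
- by rewrite size_map sn.
- by move=> _ /mapP[a + ->] => /Ss/SJ.
- by rewrite big_map -conjg_prod -gE.
Qed.

Let lenJ g h : len (g ^ h)%g = len g.
Proof.
by apply/eqP; rewrite eqn_leq lenJ_le /= -{1}(conjgK h g) lenJ_le.
Qed.

(* The word length of a conjugation-invariant generating set is conjugation
   invariant, hence induces a bi-invariant metric. *)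
Lemma bounded_group_word_bound : bounded_group R G ->
  exists N, forall g, exists s : seq G,
    [/\ (size s <= N)%N, (forall a, a \in s -> S a) & g = (\prod_(a <- s) a)%g].
Proof.
pose d x y : R := (len (x^-1 * y)%g)%:R.
move=> /(_ d)[| |D dD].
- split=> [x y|x y|x y|x y z]; first exact: ler0n.
  + split=> [/eqP|->]; last by rewrite /d mulVg len1.
    by rewrite pnatr_eq0 => /eqP/len0; rewrite -(mulVg x) => /mulgI->.
  + by rewrite /d -lenV invgM invgK.
  + rewrite /d -natrD ler_nat; apply: leq_trans (lenM _ _).
    by rewrite mulgA mulgK.
- move=> g x y; rewrite /d !invgM; split; first by rewrite mulgA mulgVK.
  by rewrite -(lenJ (x^-1 * y)%g g) conjgE !mulgA.
- have [N DN] : exists N : nat, D <= N%:R.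
    by exists (Num.truncn D).+1; exact/ltW/truncnS_gt.
  exists N => g; have [s [sn Ss gE]] := len_word g; exists s; split=> //.
  rewrite sn -(ler_nat R); apply: le_trans DN.
  by have := dD 1%g g; rewrite /d invg1 mul1g.
Qed.

End BoundedGeneration.

(** * The inner group, its action and its letters *)

Section InnerGroup.
Variable X : rackType.
Local Notation G := (inner_group X).

Lemma inner_actM (g h : G) x : inner_act (g * h)%g x = inner_act g (inner_act h x).
Proof. by []. Qed.

Lemma inner_actK (g : G) : cancel (inner_act g) (inner_act g^-1%g).
Proof. by move=> x; rewrite -inner_actM mulVg. Qed.

Lemma inner_actKV (g : G) : cancel (inner_act g^-1%g) (inner_act g).
Proof. by move=> x; rewrite -inner_actM mulgV. Qed.

Lemma inner_act_inj (g h : G) : inner_act g =1 inner_act h -> g = h.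
Proof. by move=> gh; do 2 apply: val_inj; exact/funext. Qed.

Lemma inner_psi_subproof (x : X) : rack_psi x \in generated (range (@rack_psi X)).
Proof. by apply/mem_set; apply: sub_gen_smallest; exists x. Qed.

Definition inner_psi (x : X) : G := SigSub (inner_psi_subproof x).

Lemma inner_group_ind (P : G -> Prop) :
  P 1%g -> (forall g h, P g -> P h -> P (g * h)%g) ->
  (forall g, P g -> P g^-1%g) -> (forall x, P (inner_psi x)) -> forall g, P g.
Proof.
move=> P1 PM PV Ppsi g.
pose H : set (bijection X) := [set b | exists2 h : G, val h = b & P h]%classic.
suff: (generated (range (@rack_psi X)) `<=` H)%classic.
  by move=> /(_ (val g) (set_valP g))[h /val_inj <-].
apply: smallest_sub => [|_ [x _ <-]]; last by exists (inner_psi x).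
split; first by apply/mem_set; exists 1%g.
move=> _ _ /set_mem[u <- Pu] /set_mem[v <- Pv]; apply/mem_set.
by exists (u * v^-1)%g => //; exact/PM/PV.
Qed.

(** Self-distributivity makes each [psi_x] a rack automorphism, and this passes to products and
    inverses. *)
Lemma inner_act_op (g : G) x y : inner_act g (x ▷ y) = inner_act g x ▷ inner_act g y.
Proof.
elim/inner_group_ind: g x y => [||g IH x y|z x y] //.
- by move=> g h gop hop x y; rewrite !inner_actM hop gop.
- by apply: (can_inj (inner_actK g)); rewrite IH !inner_actKV.
- exact: rack_opD.
Qed.

(** Inner automorphisms preserve the rack operation, so conjugation permutes the [inner_psi x];
    hence the letters form a conjugation-invariant set. *)
Lemma inner_psiJ (x : X) (g : G) : (inner_psi x ^ g)%g = inner_psi (inner_act g^-1%g x).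
Proof.
by apply: inner_act_inj => y; rewrite conjgE !inner_actM [LHS]inner_act_op inner_actK.
Qed.

Definition inner_letters : set G :=
  [set a | exists x, a = inner_psi x \/ a = (inner_psi x)^-1%g]%classic.

Lemma inner_lettersV a : inner_letters a -> inner_letters a^-1%g.
Proof. by case=> x [->|->]; exists x; [right|left; rewrite invgK]. Qed.

Lemma inner_group_words (R : realType) : bounded_group R G ->
  exists N, forall g, exists s : seq G,
    [/\ (size s <= N)%N, (forall a, a \in s -> inner_letters a)
      & g = (\prod_(a <- s) a)%g].
Proof.
apply: bounded_group_word_bound; first exact: inner_lettersV.
  move=> s g [x [->|->]]; exists (inner_act g^-1%g x).
    by left; rewrite inner_psiJ.
  by right; rewrite conjVg inner_psiJ.
elim/inner_group_ind => [|g h [s Ss ->] [t St ->]|g [s Ss ->]|x].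
- by exists [::] => //; rewrite big_nil.
- exists (s ++ t); last by rewrite big_cat.
  by move=> a; rewrite mem_cat => /orP[/Ss|/St].
- exists [seq a^-1%g | a <- rev s]; last by rewrite big_map prodgV revK.
  by move=> _ /mapP[a + ->]; rewrite mem_rev => /Ss/inner_lettersV.
- exists [:: inner_psi x]; last by rewrite big_seq1.
  by move=> a; rewrite inE => /eqP->; exists x; left.
Qed.

End InnerGroup.

(** * Invariant means from amenability *)

(* A mean on bounded functions, as a total operation on all functions; its
   values on unbounded functions are irrelevant. *)
Record invariant_mean (R : realType) (G : groupType) (mu : (G -> R) -> R) : Prop :=
  InvariantMean {
    mean_cst : forall c, mu (fun=> c) = c;
    mean_linear : forall a phi psi M N,
      (forall g, `|phi g| <= M) -> (forall g, `|psi g| <= N) ->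
      mu (fun g => a * phi g + psi g) = a * mu phi + mu psi;
    mean_bound : forall phi M, (forall g, `|phi g| <= M) -> `|mu phi| <= M;
    mean_translate : forall phi M h, (forall g, `|phi g| <= M) ->
      mu (fun g => phi (g * h)%g) = mu phi }.

Section Mean.
Variables (R : realType) (G : groupType).

(** The functional is extended by 0 to unbounded functions. The bound on [mu phi] is positivity
    applied to [M - phi] and [M + phi]. *)
Lemma amenable_mean :
  amenable R G -> exists mu : (G -> R) -> R, invariant_mean mu.
Proof.
case=> m [m1 m_ge0 mR].
pose mu (phi : G -> R) : R :=
  if pselect (exists M, forall g, `|phi g| <= M) is left b then m (Bfun b) else 0.
have muE phi (b : bfun R G) : (b : G -> R) = phi -> mu phi = m b.
  move=> <-; rewrite /mu; case: pselect => [b'|[]]; last exact: bfunP.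
  by congr (m _); exact: val_inj.
have mu_cst c : mu (fun=> c) = c.
  rewrite (muE _ (c *: bfun_cst G 1)).
    by rewrite linearZ/= m1 mulr1.
  by apply: funext => g; exact: mulr1.
have mu_lin a phi psi M N :
    (forall g, `|phi g| <= M) -> (forall g, `|psi g| <= N) ->
    mu (fun g => a * phi g + psi g) = a * mu phi + mu psi.
  move=> phiM psiN.
  have bphi : exists M, forall g, `|phi g| <= M by exists M.
  have bpsi : exists M, forall g, `|psi g| <= M by exists N.
  by rewrite (muE phi (Bfun bphi))// (muE psi (Bfun bpsi))// -linearP; exact: muE.
have mu_ge0 phi M : (forall g, `|phi g| <= M) -> (forall g, 0 <= phi g) -> 0 <= mu phi.
  move=> phiM phi0; have bphi : exists M, forall g, `|phi g| <= M by exists M.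
  by rewrite (muE phi (Bfun bphi))//; exact: m_ge0.
have mu_le phi M : (forall g, `|phi g| <= M) -> mu phi <= M.
  move=> phiM; have cM (g : G) : `|M| <= `|M| by [].
  rewrite -subr_ge0 (_ : M - mu phi = mu (fun g => -1 * phi g + M)).
    apply: (mu_ge0 _ (M + `|M|)) => g; rewrite mulN1r.
      by rewrite (le_trans (ler_normD _ _))// normrN lerD.
    by rewrite addrC subr_ge0; exact: le_trans (ler_norm _) (phiM g).
  by rewrite (mu_lin _ _ _ _ _ phiM cM) mu_cst mulN1r addrC.
exists mu; split=> // [phi M phiM|phi M h phiM].
- have c0 (g : G) : `|0 : R| <= 0 by rewrite normr0.
  rewrite ler_norml mu_le// andbT lerNl.
  rewrite (_ : - mu phi = mu (fun g => -1 * phi g + 0)).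
    by apply: mu_le => g; rewrite addr0 mulN1r normrN.
  by rewrite (mu_lin _ _ _ _ _ phiM c0) mu_cst mulN1r addr0.
- have bphi : exists M, forall g, `|phi g| <= M by exists M.
  by rewrite (muE phi (Bfun bphi))// -(mR h); exact: muE.
Qed.

Variables (mu : (G -> R) -> R) (mu_mean : invariant_mean mu).

Lemma meanB phi psi M N :
  (forall g, `|phi g| <= M) -> (forall g, `|psi g| <= N) ->
  mu (fun g => phi g - psi g) = mu phi - mu psi.
Proof.
move=> phiM psiN; rewrite addrC -mulN1r -(mean_linear mu_mean _ psiN phiM).
by congr mu; apply: funext => g; rewrite mulN1r addrC.
Qed.

(** The rack differential is a finite sum; this is what lets it commute with a mean. *)
Lemma mean_sum k (a : 'I_k -> R) (phi : 'I_k -> G -> R) M :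
  (forall i g, `|phi i g| <= M) ->
  mu (fun g => \sum_(i < k) a i * phi i g) = \sum_(i < k) a i * mu (phi i).
Proof.
elim: k a phi => [|k IH] a phi phiM.
  rewrite big_ord0 -[RHS](mean_cst mu_mean).
  by congr mu; apply: funext => g; rewrite big_ord0.
rewrite big_ord_recl -IH => [|i g]; last exact: phiM.
have sumM g : `|\sum_(i < k) a (lift ord0 i) * phi (lift ord0 i) g|
    <= \sum_(i < k) `|a (lift ord0 i)| * M.
  rewrite (le_trans (ler_norm_sum _ _ _))//; apply: ler_sum => i _.
  by rewrite normrM ler_wpM2l.
rewrite -(mean_linear mu_mean _ (phiM ord0) sumM).
by congr mu; apply: funext => g; rewrite big_ord_recl.
Qed.

End Mean.

(** * The rack complex sliced at the first entry *)

Section RawComplex.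
Variables (R : realType) (X : rackType).
Local Notation G := (inner_group X).
Implicit Types g h : G.

(* The rack differential on arbitrary functions; on bounded functions it agrees
   with [delta_fun]. *)
Definition rdelta k (f : ('I_k -> X) -> R) (x : 'I_k.+1 -> X) : R :=
  \sum_(i < k) (-1) ^+ i * (f (face_del i x) - f (face_act i x)).

Definition tcons k (x : X) (y : 'I_k -> X) : 'I_k.+1 -> X :=
  fun i => oapp y x (unlift ord0 i).

Definition inner_tact k g (y : 'I_k -> X) : 'I_k -> X := fun i => inner_act g (y i).

Lemma delta_funE k (f : bfun R ('I_k -> X)) : delta_fun f = rdelta f.
Proof.
apply: funext => x; rewrite /delta_fun /rdelta -sumrB.
by apply: eq_bigr => i _; rewrite mulrBr.
Qed.

Lemma tcons_eta k (y : 'I_k.+1 -> X) : y = tcons (y ord0) (fun i => y (lift ord0 i)).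
Proof. by apply: funext => i; rewrite /tcons; case: unliftP => [j|] ->. Qed.

Lemma tcons0 k x (y : 'I_k -> X) : tcons x y ord0 = x.
Proof. by rewrite /tcons unlift_none. Qed.

Lemma tconsS k x (y : 'I_k -> X) i : tcons x y (lift ord0 i) = y i.
Proof. by rewrite /tcons liftK. Qed.

Lemma inner_tact_tcons k g x (y : 'I_k -> X) :
  inner_tact g (tcons x y) = tcons (inner_act g x) (inner_tact g y).
Proof. by apply: funext => i; rewrite /inner_tact /tcons; case: unliftP. Qed.

Lemma inner_tactM k g h (y : 'I_k -> X) :
  inner_tact (g * h)%g y = inner_tact g (inner_tact h y).
Proof. by []. Qed.

Lemma face_index0 k : face_index (ord0 : 'I_k.+1) = ord0.
Proof. exact: val_inj. Qed.

Lemma lift_face_indexS k (i j : 'I_k) :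
  lift (face_index (lift ord0 i)) (lift ord0 j) = lift ord0 (lift (face_index i) j).
Proof. by apply: val_inj; rewrite /= /bump /= !add1n ltnS addnS. Qed.

Lemma lift_face_indexS0 k (i : 'I_k) : lift (face_index (lift ord0 i)) ord0 = ord0.
Proof. exact: val_inj. Qed.

Lemma face_del0 k x (y : 'I_k.+1 -> X) : face_del ord0 (tcons x y) = y.
Proof. by apply: funext => j; rewrite /face_del face_index0 tconsS. Qed.

Lemma face_act0 k x (y : 'I_k.+1 -> X) :
  face_act ord0 (tcons x y) = inner_tact (inner_psi x) y.
Proof. by apply: funext => j; rewrite /face_act face_index0 tconsS tcons0. Qed.

Lemma face_delS k x (y : 'I_k.+1 -> X) (i : 'I_k) :
  face_del (lift ord0 i) (tcons x y) = tcons x (face_del i y).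
Proof.
apply: funext => j; rewrite /face_del; case: (unliftP ord0 j) => [l|] ->.
  by rewrite lift_face_indexS !tconsS.
by rewrite lift_face_indexS0 !tcons0.
Qed.

Lemma face_actS k x (y : 'I_k.+1 -> X) (i : 'I_k) :
  face_act (lift ord0 i) (tcons x y) = tcons x (face_act i y).
Proof.
apply: funext => j; rewrite /face_act; case: (unliftP ord0 j) => [l|] ->.
  have -> : face_index (lift ord0 i) = lift ord0 (face_index i) by exact: val_inj.
  have -> : lift (lift ord0 (face_index i)) (lift ord0 l) =
            lift ord0 (lift (face_index i) l) by exact: lift_face_indexS.
  by rewrite !tconsS /= /bump /= !add1n ltnS.
by rewrite lift_face_indexS0 !tcons0.
Qed.

(* Evaluation at a first entry is a homotopy from the identity to [psi_x]. *)
Lemma rdelta_tcons k (f : ('I_k.+1 -> X) -> R) x y :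
  rdelta f (tcons x y) =
  f y - f (inner_tact (inner_psi x) y) - rdelta (fun z => f (tcons x z)) y.
Proof.
rewrite /rdelta big_ord_recl expr0 mul1r face_del0 face_act0; congr (_ + _).
rewrite -sumrN; apply: eq_bigr => i _.
by rewrite face_delS face_actS lift0 exprS -mulrA mulN1r.
Qed.

Lemma face_del_inner k g (x : 'I_k.+1 -> X) i :
  face_del i (inner_tact g x) = inner_tact g (face_del i x).
Proof. by []. Qed.

Lemma face_act_inner k g (x : 'I_k.+1 -> X) i :
  face_act i (inner_tact g x) = inner_tact g (face_act i x).
Proof.
apply: funext => j; rewrite /face_act /inner_tact.
by case: ifP => // _; rewrite inner_act_op.
Qed.

(** The diagonal action is by rack automorphisms, hence commutes with every face. *)
Lemma rdelta_inner k g (f : ('I_k -> X) -> R) x :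
  rdelta (fun y => f (inner_tact g y)) x = rdelta f (inner_tact g x).
Proof. by apply: eq_bigr => i _; rewrite face_del_inner face_act_inner. Qed.

Lemma rdelta0 k x : rdelta (fun _ : 'I_k -> X => 0 : R) x = 0.
Proof. by rewrite /rdelta big1// => i _; rewrite subrr mulr0. Qed.

Lemma rdeltaN k (f : ('I_k -> X) -> R) x : rdelta (fun y => - f y) x = - rdelta f x.
Proof.
by rewrite /rdelta -sumrN; apply: eq_bigr => i _; rewrite -mulrN opprB opprK addrC.
Qed.

Lemma rdeltaD k (f f' : ('I_k -> X) -> R) x :
  rdelta (fun y => f y + f' y) x = rdelta f x + rdelta f' x.
Proof.
by rewrite /rdelta -big_split; apply: eq_bigr => i _ /=; rewrite -mulrDr opprD addrACA.
Qed.

Lemma rdelta_bound k (f : ('I_k -> X) -> R) M x :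
  (forall y, `|f y| <= M) -> `|rdelta f x| <= (M + M) *+ k.
Proof.
move=> fM; rewrite (le_trans (ler_norm_sum _ _ _))//.
rewrite -[leRHS](_ : \sum_(i < k) (M + M) = _); last by rewrite sumr_const card_ord.
apply: ler_sum => i _; rewrite normrM normrX normrN1 expr1n mul1r.
by rewrite (le_trans (ler_normB _ _))// lerD.
Qed.

(** * Homotopies from a cocycle to its translates *)

Lemma cocycle_letter_homotopy n (f : ('I_n.+1 -> X) -> R) M a :
  (forall z, rdelta f z = 0) -> (forall y, `|f y| <= M) -> inner_letters a ->
  exists2 c : ('I_n -> X) -> R, forall y, `|c y| <= M &
    forall y, f y - f (inner_tact a y) = rdelta c y.
Proof.
move=> df fM [x].
have psiE y : f y - f (inner_tact (inner_psi x) y) = rdelta (fun z => f (tcons x z)) y.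
  by apply/eqP; rewrite -subr_eq0 -rdelta_tcons df.
case=> ->; first by exists (fun z => f (tcons x z)).
(* Substituting [psi_x^-1 y] in the identity for [psi_x] exchanges its two terms, whence the
   sign. *)
exists (fun z => - f (tcons x (inner_tact (inner_psi x)^-1%g z))) => [y|y].
  by rewrite normrN.
rewrite rdeltaN (rdelta_inner _ (fun z => f (tcons x z))) -psiE opprB.
by rewrite -inner_tactM mulgV.
Qed.

(** Telescoping along the word: each letter adds a translated primitive of norm at most [M]. *)
Lemma cocycle_word_homotopy n (f : ('I_n.+1 -> X) -> R) M (s : seq G) :
  (forall z, rdelta f z = 0) -> (forall y, `|f y| <= M) ->
  (forall a, a \in s -> inner_letters a) ->
  exists2 c : ('I_n -> X) -> R, forall y, `|c y| <= (size s)%:R * M &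
    forall y, f y - f (inner_tact (\prod_(a <- s) a)%g y) = rdelta c y.
Proof.
move=> df fM; elim: s => [_|a s IH Ss].
  exists (fun=> 0) => y; first by rewrite normr0 mul0r.
  by rewrite big_nil subrr rdelta0.
have [|c cM cE] := IH; first by move=> b bs; apply: Ss; rewrite inE bs orbT.
have [|d dM dE] := @cocycle_letter_homotopy _ f M a df fM.
  by apply: Ss; rewrite inE eqxx.
exists (fun y => c y + d (inner_tact (\prod_(a <- s) a)%g y)) => y.
  by rewrite (le_trans (ler_normD _ _))// -natr1 mulrDl mul1r lerD.
by rewrite rdeltaD rdelta_inner -cE -dE big_cons inner_tactM addrA subrK.
Qed.

(** * Averaging cochains over the inner group *)

Variables (mu : (G -> R) -> R) (mu_mean : invariant_mean mu).

Definition average k (f : ('I_k -> X) -> R) (y : 'I_k -> X) : R :=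
  mu (fun g => f (inner_tact g y)).

Lemma rdelta_mean k (F : G -> ('I_k -> X) -> R) M x : (forall g y, `|F g y| <= M) ->
  rdelta (fun y => mu (F^~ y)) x = mu (fun g => rdelta (F g) x).
Proof.
move=> FM; rewrite [RHS](@mean_sum _ _ _ mu_mean _ _ _ (M + M)) => [|i g].
  by apply: eq_bigr => i _; rewrite (meanB mu_mean (M := M) (N := M)).
by rewrite (le_trans (ler_normB _ _))// lerD.
Qed.

Lemma rdelta_average k (f : ('I_k -> X) -> R) M x : (forall y, `|f y| <= M) ->
  rdelta (average f) x = average (rdelta f) x.
Proof.
move=> fM; rewrite (@rdelta_mean _ (fun g y => f (inner_tact g y)) M) => [|g y //].
by congr mu; apply: funext => g; rewrite rdelta_inner.
Qed.

Lemma average_bound k (f : ('I_k -> X) -> R) M y :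
  (forall y, `|f y| <= M) -> `|average f y| <= M.
Proof. by move=> fM; apply: (mean_bound mu_mean). Qed.

(** Moving [y] by [h] right-translates the averaged function of [g]. *)
Lemma average_inner k (f : ('I_k -> X) -> R) M h y : (forall y, `|f y| <= M) ->
  average f (inner_tact h y) = average f y.
Proof.
move=> fM.
by apply: (mean_translate mu_mean (phi := fun g => f (inner_tact g y)) (M := M)).
Qed.

(* For invariant cochains the first face contributes nothing, so slicing off the
   first entry lowers the degree. *)
Lemma rdelta_tcons_invariant k (f : ('I_k.+1 -> X) -> R) x y :
  (forall h y, f (inner_tact h y) = f y) ->
  rdelta f (tcons x y) = - rdelta (fun z => f (tcons x z)) y.
Proof. by move=> fI; rewrite rdelta_tcons fI subrr add0r. Qed.

(** * Functions constant on components *)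

(** Invariance in each entry separately, stronger than the diagonal invariance that averaging
    provides; these functions factor through [pi0^k]. *)
Definition componentwise k (f : ('I_k -> X) -> R) :=
  forall y z, (forall i, component (y i) = component (z i)) -> f y = f z.

Lemma component_inner g x : component (inner_act g x) = component x.
Proof.
apply/seteqP; split=> _ [h _ <-].
  by exists (h * g)%g => //; rewrite inner_actM.
by exists (h * g^-1)%g => //; rewrite inner_actM inner_actK.
Qed.

Lemma component_eqP x y : component x = component y -> exists g, y = inner_act g x.
Proof.
move=> xy; have : component y y by exists 1%g.
by rewrite -xy => -[g _ <-]; exists g.
Qed.

Lemma componentwise_inner k (f : ('I_k -> X) -> R) h y :
  componentwise f -> f (inner_tact h y) = f y.
Proof. by move=> fC; apply: fC => i; exact: component_inner. Qed.

(** Entry by entry, the two kinds of face differ by at most an inner automorphism, so their terms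
    cancel. *)
Lemma componentwise_cocycle k (f : ('I_k -> X) -> R) x : componentwise f -> rdelta f x = 0.
Proof.
move=> fC; rewrite /rdelta big1// => i _.
rewrite (fC (face_act i x) (face_del i x)) ?subrr ?mulr0// => j.
rewrite /face_act; case: ifP => // _.
exact: (component_inner (inner_psi _)).
Qed.

Lemma componentwise_tcons k (f : ('I_k.+1 -> X) -> R) x :
  componentwise f -> componentwise (fun z => f (tcons x z)).
Proof.
by move=> fC y z yz; apply: fC => i; rewrite /tcons; case: unliftP => [j|] _ /=.
Qed.

(** Averaging fixes [f], so its primitive may be taken invariant; slicing then lowers the degree. At
    the bottom, the differential out of degree 0 is an empty sum. *)
Lemma componentwise_coboundary0 n (f : ('I_n.+1 -> X) -> R) c M :
  componentwise f -> (forall y, `|c y| <= M) -> (forall y, f y = rdelta c y) ->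
  forall y, f y = 0.
Proof.
elim: n f c M => [|n IH] f c M fC cM fE y; first by rewrite fE /rdelta big_ord0.
have fE' z : f z = rdelta (average c) z.
  rewrite (rdelta_average _ cM) -[LHS](mean_cst mu_mean).
  by congr mu; apply: funext => g; rewrite -fE componentwise_inner.
rewrite (tcons_eta y); set x := y ord0; set z := (fun i => _).
apply: (IH (fun z => f (tcons x z)) (fun z => - average c (tcons x z)) M).
- exact: componentwise_tcons.
- by move=> u; rewrite normrN average_bound.
- move=> u; rewrite fE' rdelta_tcons_invariant ?rdeltaN// => h v.
  exact: average_inner cM.
Qed.

(** A homotopy is chosen for each [g]; the word bound [N] makes them uniformly bounded, so that they
    can be averaged over [g]. *)
Lemma cocycle_average n (f : ('I_n.+1 -> X) -> R) M N :
  0 <= M ->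
  (forall g, exists s : seq G,
    [/\ (size s <= N)%N, (forall a, a \in s -> inner_letters a)
      & g = (\prod_(a <- s) a)%g]) ->
  (forall z, rdelta f z = 0) -> (forall y, `|f y| <= M) ->
  exists2 c : ('I_n -> X) -> R, forall y, `|c y| <= N%:R * M &
    forall y, f y - average f y = rdelta c y.
Proof.
move=> M0 words df fM.
have : forall g, exists c : ('I_n -> X) -> R, (forall y, `|c y| <= N%:R * M) /\
    (forall y, f y - f (inner_tact g y) = rdelta c y).
  move=> g; have [s [sN Ss ->]] := words g.
  have [c cM cE] := cocycle_word_homotopy df fM Ss.
  by exists c; split=> // y; rewrite (le_trans (cM y))// ler_wpM2r// ler_nat.
move=> /choice[c cP]; exists (fun y => mu (c^~ y)) => y.
  by apply: (mean_bound mu_mean) => g; have [] := cP g.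
rewrite (@rdelta_mean _ c (N%:R * M)) => [|g z]; last by have [] := cP g.
rewrite -[f y in LHS](mean_cst mu_mean).
rewrite -(meanB mu_mean (M := `|f y|) (N := M))//.
by congr mu; apply: funext => g; rewrite (cP g).2.
Qed.

(** [K] is fixed before [f]: the induction glues the primitives of all slices into one cochain,
    which has to be bounded. *)
Lemma cocycle_componentwise n N :
  (forall g, exists s : seq G,
    [/\ (size s <= N)%N, (forall a, a \in s -> inner_letters a)
      & g = (\prod_(a <- s) a)%g]) ->
  exists K : R, forall (f : ('I_n.+1 -> X) -> R) (M : R), 0 <= M ->
  (forall z, rdelta f z = 0) -> (forall y, `|f y| <= M) ->
  exists2 c : ('I_n -> X) -> R, forall y, `|c y| <= K * M &
    componentwise (fun y => f y - rdelta c y).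
Proof.
move=> words; elim: n => [|n [K IH]].
  (* In degree one the word homotopies are empty sums, so [f] is itself constant on components. *)
  exists 0 => f M M0 df fM; exists (fun=> 0) => [y|y z yz].
    by rewrite normr0 mul0r.
  have [g zE] := component_eqP (yz ord0).
  have -> : z = inner_tact g y by apply: funext => i; rewrite (ord1 i).
  have [s [_ Ss gE]] := words g; have [d _ dE] := cocycle_word_homotopy df fM Ss.
  by rewrite !rdelta0 !subr0; apply/eqP; rewrite -subr_eq0 gE dE /rdelta big_ord0.
(* [N] pays for averaging [f], and [K] for the glued primitives of the slices. *)
exists (N%:R + K) => f M M0 df fM.
have [c1 c1M c1E] := cocycle_average M0 words df fM.
pose f' := average f.
have f'M y : `|f' y| <= M by exact: average_bound.
have f'I h y : f' (inner_tact h y) = f' y by exact: average_inner fM.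
have df' z : rdelta f' z = 0.
  rewrite (rdelta_average _ fM) -[RHS](mean_cst mu_mean).
  by congr mu; apply: funext => g.
have : forall x, exists c : ('I_n -> X) -> R, (forall y, `|c y| <= K * M) /\
    componentwise (fun y => f' (tcons x y) - rdelta c y).
  move=> x; have [z|y|c cM cC] := IH (fun y => f' (tcons x y)) M M0.
  - by rewrite -[LHS]opprK -rdelta_tcons_invariant// df' oppr0.
  - exact: f'M.
  - by exists c.
move=> /choice[c cP].
(* [L x] is constant on components for each [x], but the [c x] are chosen independently, so the
   dependence on [x] is still arbitrary. *)
pose L x y := f' (tcons x y) - rdelta (c x) y.
have LM x y : `|L x y| <= M + (K * M + K * M) *+ n.
  rewrite (le_trans (ler_normB _ _))// lerD// rdelta_bound//.
  by have [] := cP x.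
pose C (y : 'I_n.+1 -> X) := c (y ord0) (fun i => y (lift ord0 i)).
have CM y : `|C y| <= K * M by exact: (cP _).1.
have Cinner g x y : C (inner_tact g (tcons x y)) = c (inner_act g x) (inner_tact g y).
  rewrite inner_tact_tcons /C tcons0.
  rewrite (_ : (fun i => _) = inner_tact g y)//.
  by apply: funext => i; rewrite tconsS.
(* Correcting by [average C] replaces [L x] by its mean along the orbit of [x], which depends only
   on the component of [x]. The plus sign compensates the sign of slicing. *)
have f'E x y : f' (tcons x y) + rdelta (average C) (tcons x y)
    = mu (fun g => L (inner_act g x) y).
  rewrite rdelta_tcons_invariant; last by move=> h z; exact: average_inner CM.
  rewrite (@rdelta_mean _ (fun g z => C (inner_tact g (tcons x z))) (K * M))//.
  rewrite -[f' _](mean_cst mu_mean).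
  rewrite -(meanB mu_mean (M := `|f' (tcons x y)|) (N := (K * M + K * M) *+ n))//.
    congr mu; apply: funext => g.
    (* As [L (inner_act g x)] is constant on components, [g] may act on [y] too; both terms then
       become diagonal translates. *)
    have -> : L (inner_act g x) y = L (inner_act g x) (inner_tact g y).
      by apply: (cP _).2 => i; rewrite component_inner.
    rewrite /L -inner_tact_tcons f'I -rdelta_inner; congr (_ - _).
    by apply: eq_bigr => i _; rewrite !Cinner.
  move=> g; apply: (@rdelta_bound n _ (K * M)) => z; exact: CM.
exists (fun y => c1 y - average C y) => [y|y z yz].
  by rewrite (le_trans (ler_normB _ _))// mulrDl lerD// average_bound.
have fE u : f u - rdelta (fun y => c1 y - average C y) u
    = f' u + rdelta (average C) u.
  by rewrite rdeltaD rdeltaN -c1E opprD opprK addrA subKr.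
rewrite !fE (tcons_eta y) (tcons_eta z) !f'E.
have [h ->] := component_eqP (yz ord0).
rewrite -(mean_translate mu_mean h (phi := fun g => L (inner_act g (y ord0)) _)
            (M := M + (K * M + K * M) *+ n))//.
congr mu; apply: funext => g; rewrite inner_actM.
by apply: (cP _).2 => i; exact: yz.
Qed.
End RawComplex.

(** * The comparison map from functions on components to cohomology *)

Section Comparison.
Local Open Scope quotient_scope.
Variables (R : realType) (X : rackType) (k : nat).

Fact pi0_class_subproof (x : X) : component x \in range (@component X).
Proof. by apply/mem_set; exists x. Qed.

Definition pi0_class (x : X) : pi0 X := SigSub (pi0_class_subproof x).

Lemma pi0_class_surj (p : pi0 X) : exists x, pi0_class x = p.
Proof. by have [x _ xp] := set_valP p; exists x; exact: val_inj. Qed.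

Definition pi0_pullback (L : bfun R ('I_k -> pi0 X)) : bfun R ('I_k -> X) :=
  bfun_comp L (fun y i => pi0_class (y i)).

Lemma pi0_pullback_componentwise L : componentwise (pi0_pullback L).
Proof.
move=> y z yz; congr (bfun_fun L _); apply: funext => i.
by apply: val_inj; exact: yz.
Qed.

Lemma delta_ext (f : bfun R ('I_k -> X)) (h : bfun R ('I_k.+1 -> X)) :
  (forall y, h y = rdelta f y) -> delta f = h.
Proof.
move=> hE; apply: val_inj; rewrite /= delta_funE.
by apply: funext => y; rewrite -hE.
Qed.

Fact pi0_pullback_cocycle L : pi0_pullback L \in @cocycles R X k.
Proof.
apply/mem_set; apply: delta_ext => y.
by rewrite componentwise_cocycle//; exact: pi0_pullback_componentwise.
Qed.

Definition pi0_cocycle L : cocycle R X k := SigSub (pi0_pullback_cocycle L).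

Local Notation H := (lmod_quot (cocycle_coboundaries_submod R X k)).

Definition pi0_comparison (L : bfun R ('I_k -> pi0 X)) : rack_bounded_cohomology R X k :=
  \pi_H (pi0_cocycle L).

Fact pi0_comparison_linear : linear pi0_comparison.
Proof.
move=> a L L'; rewrite /pi0_comparison.
have -> : pi0_cocycle (a *: L + L') = a *: pi0_cocycle L + pi0_cocycle L'.
  by do 2 apply: val_inj.
rewrite raddfD; congr (_ + _). 
exact/esym/lmod_quot_scale_pi.
Qed.

HB.instance Definition _ :=
  GRing.isLinear.Build R (bfun R ('I_k -> pi0 X)) (rack_bounded_cohomology R X k) _
    pi0_comparison pi0_comparison_linear.

Lemma cohomology_piP (u v : cocycle R X k) :
  \pi_H u = \pi_H v <-> coboundaries (val u - val v).
Proof.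
have E : (u - v \in @cocycle_coboundaries R X k) = (\pi_H u == \pi_H v).
  exact: (Quotient.idealrBE (submod_pred (cocycle_coboundaries_submod R X k))).
split=> [uv|uv]; last by apply/eqP; rewrite -E; apply/mem_set.
by have := E; rewrite uv eqxx => /set_mem.
Qed.

Lemma pi0_pullback_onto (f : bfun R ('I_k -> X)) :
  componentwise f -> exists L, pi0_pullback L = f.
Proof.
move=> fC; have [s sK] := choice pi0_class_surj.
exists (bfun_comp f (fun u i => s (u i))).
apply: val_inj; apply: funext => y; apply: fC => i.
exact: (congr1 val (sK (pi0_class (y i)))).
Qed.

Lemma pi0_pullback_inj : injective pi0_pullback.
Proof.
move=> L L' LL'; apply: val_inj; apply: funext => u.
have [s sK] := choice pi0_class_surj.
have -> : u = (fun i => pi0_class (s (u i))) by apply: funext => i; rewrite sK.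
exact: (congr1 (fun f : bfun R ('I_k -> X) => f (fun i => s (u i))) LL').
Qed.

End Comparison.

(** * Bijectivity of the comparison map *)

Lemma pi0_comparison_inj (R : realType) (X : rackType) k :
  amenable R (inner_group X) -> injective (@pi0_comparison R X k).
Proof.
move=> /amenable_mean[mu mu_mean] L L' /cohomology_piP /= LL'.
apply: pi0_pullback_inj; apply/eqP; rewrite -subr_eq0; apply/eqP.
have LC : componentwise (pi0_pullback L - pi0_pullback L' : bfun R ('I_k -> X)).
  move=> y z yz; congr (_ - _); exact: pi0_pullback_componentwise.
(* In degree 0 the only coboundary is 0, so the hypothesis is the claim. *)
case: k L L' LL' LC => [|k] L L'; first by [].
move=> [c _ cE] LC; have [M cM] := bfunP c.
apply: val_inj; apply: funext => y.
apply: (componentwise_coboundary0 mu_mean LC cM) => z.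
by rewrite -cE -delta_funE.
Qed.

Lemma pi0_comparison_surj (R : realType) (X : rackType) k :
  bounded_group R (inner_group X) -> amenable R (inner_group X) ->
  forall y, exists L, @pi0_comparison R X k L = y.
Proof.
move=> /inner_group_words[N words] /amenable_mean[mu mu_mean] y.
rewrite -[y]reprK; move: (repr y) => z {y}.
suff [L LE] : exists L, coboundaries (pi0_pullback L - val z).
  by exists L; apply/cohomology_piP.
case: k z => [|k] z.
  have [|L LE] := @pi0_pullback_onto _ _ _ (val z).
    (* There is only one empty tuple. *)
    by move=> u v uv; congr (bfun_fun _ _); apply: funext => -[].
  by exists L; rewrite /= LE subrr.
have [K KP] := cocycle_componentwise mu_mean k words.
pose zf : bfun R ('I_k.+1 -> X) := val z; have [M zM] := bfunP zf.
(* A point of the rack gives a tuple at which to evaluate the bound, whence [0 <= M]. *)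
have [x0] := @rack_inhabited X.
have M0 : 0 <= M by exact: le_trans (zM (fun=> x0)).
have dz u : rdelta zf u = 0.
  rewrite -delta_funE; have := set_valP z.
  by move=> /(congr1 (fun f : bfun R ('I_k.+2 -> X) => f u)).
have [c cM cC] := KP zf M M0 dz zM.
(* The coboundary sought is the pullback minus [z], so its primitive is [- c]. *)
have bc : exists M, forall u, `|- c u| <= M.
  by exists (K * M) => u; rewrite normrN.
pose f : bfun R ('I_k.+1 -> X) := zf + delta (Bfun bc).
have fE u : f u = zf u - rdelta c u.
  by rewrite [f u]/(zf u + delta_fun (Bfun bc) u) delta_funE (rdeltaN c).
have [|L LE] := @pi0_pullback_onto _ _ _ f.
  by move=> u v uv; rewrite !fE; exact: cC.
by exists L, (Bfun bc) => //; rewrite LE addrAC subrr add0r.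
Qed.

Theorem theorem1p3 (R : realType) (X : rackType)
    (inner_bounded : bounded_group R (inner_group X))
    (inner_amenable : amenable R (inner_group X)) (k : nat) :
  exists phi : {linear bfun R ('I_k -> pi0 X) -> rack_bounded_cohomology R X k},
    bijective phi.
Proof.
have [g gK] := choice (@pi0_comparison_surj R X k inner_bounded inner_amenable).
exists (@pi0_comparison R X k : {linear _ -> _}); exists g => // L.
exact/(pi0_comparison_inj inner_amenable)/gK.
Qed.
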